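(* Let $\mu>0$ be real, let $k,M\ge 1$ be integers, put $\hat m=2^{k-1}M$, and let $\hat\Psi^{\mu}$ be the fractional Bernoulli wavelet (FBW) vector with entries $\psi^{\mu}_{n,m}$ ($n=1,\dots,2^{k-1}$, $m=0,\dots,M-1$). Then, with $\approx$ denoting the FBW approximation defined in the context, the Riemann-Liouville fractional integral of order $\mu$ of the vector $\hat\Psi^{\mu}$ satisfies $$\mathcal I^{\mu}(\hat\Psi^{\mu}(\zeta))\approx \mathcal P^{\mu}\,\hat\Psi^{\mu}(\zeta),$$ where $\mathcal P^{\mu}$ (the fractional-order integral operational matrix) is the $\hat m\times\hat m$ matrix whose entry in the row indexed by $(n,m)$ and the column indexed by $(r,l)$ is the number $\Theta^{\mu;nm}_{rl}$ given below. That is, for all $n=1,2,\dots,2^{k-1}$ and $m=0,1,\dots,M-1$, $$\mathcal I^{\mu}(\psi^{\mu}_{n,m}(\zeta))\approx\sum_{r=1}^{2^{k-1}}\sum_{l=0}^{M-1}\Theta^{\mu;nm}_{rl}\,\psi^{\mu}_{r,l}(\zeta),$$ where $$\Theta^{\mu;nm}_{rl}=\begin{cases}\displaystyle \xi_m\sum_{j=0}^{m}\binom{m}{j}B_{m-j}(0)\,2^{(k-1)j}\,c^{1j}_{rl}, & n=1,\\[2mm] \displaystyle \xi_m\sum_{j=0}^{m}\sum_{q=0}^{j}\binom{m}{j}\binom{j}{q}B_{m-j}(0)\,2^{(k-1)q}(-1)^{j-q}(n-1)^{j-q}\,c^{nq}_{rl}, & n\ne 1,\end{cases}$$ and $c^{nq}_{rl}$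 are the coefficients of the FBW approximation $g_{nq}\approx\sum_{r=1}^{2^{k-1}}\sum_{l=0}^{M-1}c^{nq}_{rl}\,\psi^{\mu}_{r,l}$ of the function $g_{nq}=\mathcal I^{\mu}\big(\zeta^{\mu q}\chi_n(\zeta)\big)$.
   Context: $B_m(\zeta)=\sum_{j=0}^m\binom mj B_{m-j}(0)\zeta^j$ are the Bernoulli polynomials and $B_j(0)$ the Bernoulli numbers. For $m\ge1$, $\xi_m=\sqrt{\dfrac{2^{k-1}(2m)!}{(-1)^{m-1}(m!)^2B_{2m}(0)}}$, and $\xi_0=2^{(k-1)/2}$. For $n=1,\dots,2^{k-1}$, $\chi_n$ denotes the characteristic function of the interval $\left[\left(\frac{n-1}{2^{k-1}}\right)^{1/\mu},\left(\frac{n}{2^{k-1}}\right)^{1/\mu}\right)$. The fractional Bernoulli wavelets on $[0,1)$ are $$\psi^{\mu}_{n,m}(\zeta)=\xi_m\sum_{j=0}^m\binom mj B_{m-j}(0)\,2^{(k-1)j}\left(\zeta^{\mu}-\frac{n-1}{2^{k-1}}\right)^{j}\chi_n(\zeta),\qquad n=1,\dots,2^{k-1},\ m=0,1,\dots,M-1,$$ and $\hat\Psi^{\mu}=[\psi^{\mu}_{1,0},\psi^{\mu}_{1,1},\dots,\psi^{\mu}_{1,M-1},\dots,\psi^{\mu}_{2^{k-1},M-1}]^T$ is the column vector of all of them. The Riemann-Liouville fractional integral of order $\mu>0$ is $\mathcal I^{\mu}f(\zeta)=\frac1{\Gamma(\mu)}\int_0^{\zeta}(\zeta-s)^{\mu-1}f(s)\,ds$,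 applied entrywise to vectors. FBW approximation: for $f$ square integrable on $[0,1]$, $f\approx \hat C^T\hat\Psi^{\mu}$ means that the coefficient vector is $\hat C^T=\left(\int_0^1 f(\zeta)(\hat\Psi^{\mu}(\zeta))^T d\zeta\right)\hat D(\mu)^{-1}$, where $\hat D(\mu)=\int_0^1\hat\Psi^{\mu}(\zeta)(\hat\Psi^{\mu}(\zeta))^T d\zeta$ (so $\hat C^T\hat\Psi^{\mu}$ is the $L^2[0,1]$-orthogonal projection of $f$ onto the span of the $\psi^{\mu}_{r,l}$). For vectors of functions, $\approx$ is understood entrywise. *)

(* Defs.v *)
From HB Require Import structures.
From mathcomp Require Import all_boot all_order all_algebra.
From mathcomp Require Import all_classical all_reals all_analysis.
Import Order.TTheory GRing.Theory Num.Theory.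
Import numFieldNormedType.Exports.

Set Implicit Arguments.
Unset Strict Implicit.
Unset Printing Implicit Defensive.

Local Open Scope classical_set_scope.
Local Open Scope ring_scope.

(* [:: B_0; ...; B_n], from \sum_(j < m.+1) 'C(m.+1, j) B_j = 0 for m >= 1;
   hence the convention B_1 = - 1/2, i.e. B_m is the value at 0 of the m-th
   Bernoulli polynomial. *)
Fixpoint bernoulli_seq (F : fieldType) (n : nat) : seq F :=
  if n is m.+1 then
    let s := bernoulli_seq F m in
    rcons s (- (m.+2%:R)^-1 * \sum_(j < m.+1) 'C(m.+2, j)%:R * s`_j)
  else [:: 1].

Definition bernoulli_num (F : fieldType) (n : nat) : F :=
  (bernoulli_seq F n)`_n.

Section FractionalBernoulliWavelets.
Context {R : realType}.
Implicit Types (f : R -> R) (mu : R) (k M n m j q : nat).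

Local Notation leb := (@lebesgue_measure R).
Local Notation B := (bernoulli_num R).

Definition Gamma (a : R) : R :=
  \int[leb]_(t in `[0, +oo[) (t `^ (a - 1) * expR (- t)).

Definition RLint mu f (z : R) : R :=
  (Gamma mu)^-1 * \int[leb]_(s in `[0, z]) ((z - s) `^ (mu - 1) * f s).

Definition RLint_vec mu (N : nat) (F : R -> 'cV[R]_N) (z : R) : 'cV[R]_N :=
  \col_i RLint mu (fun s => F s i 0) z.

Definition xi k m : R :=
  if m == 0 then 2 `^ (k.-1%:R / 2)
  else Num.sqrt (2 ^+ k.-1 * ((2 * m)`!)%:R /
                 ((-1) ^+ m.-1 * (m`!)%:R ^+ 2 * B (2 * m))).

(* In chi, psi, g and Theta the index n is 1-based: n = 1, ..., 2 ^ k.-1. *)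
Definition chi mu k n : R -> R :=
  \1_(`[ ((n%:R - 1) / 2 ^+ k.-1) `^ mu^-1, (n%:R / 2 ^+ k.-1) `^ mu^-1 [
        : set R).

Definition psi mu k n m (z : R) : R :=
  xi k m * (\sum_(j < m.+1) 'C(m, j)%:R * B (m - j) * 2 ^+ (k.-1 * j) *
              (z `^ mu - (n%:R - 1) / 2 ^+ k.-1) ^+ j) * chi mu k n z.

(* mxvec is row-major, so the entries are ordered as
   psi_{1,0}, ..., psi_{1,M-1}, ..., psi_{2^(k-1),M-1}. *)
Definition Psi mu k M (z : R) : 'cV[R]_(2 ^ k.-1 * M) :=
  (mxvec (\matrix_(n < 2 ^ k.-1, m < M) psi mu k n.+1 m z))^T.

Definition fbw_gram mu k M : 'M[R]_(2 ^ k.-1 * M) :=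
  \matrix_(i, j) \int[leb]_(z in `[0, 1]) (Psi mu k M z *m (Psi mu k M z)^T) i j.

Definition fbw_coef mu k M f : 'rV[R]_(2 ^ k.-1 * M) :=
  (\row_j \int[leb]_(z in `[0, 1]) (f z *: (Psi mu k M z)^T) 0 j)
    *m invmx (fbw_gram mu k M).

Definition square_integrable01 f : Prop :=
  measurable_fun (`[0, 1] : set R) f /\
  leb.-integrable `[0, 1] (fun z => (f z ^+ 2)%:E).

(* f ~ C Psi. As invmx is total, the invertibility of the Gram matrix, which
   the formula for the coefficients presupposes, is asserted explicitly. *)
Definition fbw_approx mu k M f (C : 'rV[R]_(2 ^ k.-1 * M)) : Prop :=
  [/\ square_integrable01 f,
      fbw_gram mu k M \in unitmx &
      C = fbw_coef mu k M f].

Definition fbw_approx_vec mu k M (N : nat) (F : R -> 'cV[R]_N)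
    (A : 'M[R]_(N, 2 ^ k.-1 * M)) : Prop :=
  forall i, fbw_approx mu (fun z => F z i 0) (row i A).

Definition g mu k n q : R -> R :=
  RLint mu (fun s => s `^ (mu * q%:R) * chi mu k n s).

Definition g_coef mu k M n q : 'M[R]_(2 ^ k.-1, M) :=
  vec_mx (fbw_coef mu k M (g mu k n q)).

Definition Theta mu k M n m (r : 'I_(2 ^ k.-1)) (l : 'I_M) : R :=
  if n == 1 then
    xi k m * \sum_(j < m.+1) 'C(m, j)%:R * B (m - j) * 2 ^+ (k.-1 * j) *
      g_coef mu k M 1 j r l
  else
    xi k m * \sum_(j < m.+1) \sum_(q < j.+1)
      'C(m, j)%:R * 'C(j, q)%:R * B (m - j) * 2 ^+ (k.-1 * q) *
      (-1) ^+ (j - q) * (n%:R - 1) ^+ (j - q) * g_coef mu k M n q r l.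

Definition Theta_mx mu k M n m : 'M[R]_(2 ^ k.-1, M) :=
  \matrix_(r, l) Theta mu n m r l.

(* By mxvecE, the entry of Pmx at row mxvec_index n m and column
   mxvec_index r l is Theta mu n.+1 m r l. *)
Definition Pmx mu k M : 'M[R]_(2 ^ k.-1 * M) :=
  \matrix_(i, j)
    mxvec (\matrix_(n < 2 ^ k.-1, m < M) mxvec (Theta_mx mu k M n.+1 m) 0 j) 0 i.

End FractionalBernoulliWavelets.

(* Main.v *)
Require Import Defs.
From mathcomp Require Import all_boot all_order all_algebra.
From mathcomp Require Import finmap all_classical all_reals all_analysis.
From mathcomp Require Import measurable_realfun.
From mathcomp Require Import ring.
Import Order.TTheory GRing.Theory Num.Theory.
Import numFieldNormedType.Exports.

(** On its cell a wavelet is a polynomial in [s `^ mu] cut off by the indicator of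
    the cell: the binomial theorem writes it as a linear combination of the functions
    [s `^ (mu * q) * chi s] ([psiE]). The Riemann-Liouville integral is linear, hence
    maps it to the same combination of the functions [g] ([RLint_psi]), and the
    coefficient vector of an approximation depends linearly on the function. This
    gives the entries of the operational matrix ([fbw_coef_RLint_psi]).

    For this computation to be about actual integrals, the singular kernel
    [(z - s) `^ (mu - 1)] has to be integrable on [`[0, z]], with integral at most
    [z `^ mu / mu] ([integral_kernel_le]). The integral then maps bounded measurable
    functions on the unit interval to bounded measurable functions
    ([bounded_mfun01_RLint]), which also yields square integrability.

    The remaining point is that the Gram matrix is invertible ([fbw_gram_unit]), that
    is, that the wavelets are linearly independent modulo null sets. Wavelets of
    different cells have disjoint supports, and within a cell they are multiples of
    polynomials of pairwise different degrees in [z `^ mu]; a nonzero polynomial has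
    finitely many roots. The multiples are nonzero because [xi k m] is, which amounts
    to [0 < (-1) ^+ m.-1 * B (2 * m)] ([bernoulli_num_sign]). That inequality comes
    from a Riccati equation: q = (x / 2) coth (x / 2) = x / (exp x - 1) + x / 2
    satisfies x q' + q^2 - q = x^2 / 4, and comparing coefficients expresses each
    coefficient as minus a sum of products of the previous ones, which forces the
    odd coefficients to vanish and the even ones to alternate in sign. *)

Set Implicit Arguments.
Unset Strict Implicit.
Unset Printing Implicit Defensive.
Local Open Scope ring_scope.

(** * Signs of the Bernoulli numbers *)

Section BernoulliNumbers.
Variable F : numFieldType.
Local Notation B := (bernoulli_num F).

Lemma size_bernoulli_seq n : size (bernoulli_seq F n) = n.+1.
Proof. by elim: n => //= n IH; rewrite size_rcons IH. Qed.

Lemma nth_bernoulli_seq n j : (j <= n)%N -> (bernoulli_seq F n)`_j = B j.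
Proof.
elim: n => [|n IH]; first by rewrite leqn0 => /eqP ->.
rewrite leq_eqVlt => /orP[/eqP-> //|].
by rewrite ltnS => jn; rewrite /= nth_rcons size_bernoulli_seq ltnS jn IH.
Qed.

Lemma bernoulli_num0 : B 0 = 1.
Proof. by []. Qed.

Lemma bernoulli_numS m :
  B m.+1 = - (m.+2%:R)^-1 * \sum_(j < m.+1) 'C(m.+2, j)%:R * B j.
Proof.
rewrite /bernoulli_num /= nth_rcons size_bernoulli_seq ltnn eqxx.
by congr (_ * _); apply: eq_bigr => j _; rewrite nth_bernoulli_seq // -ltnS.
Qed.

Lemma sum_bernoulli_num m :
  \sum_(j < m.+1) 'C(m.+1, j)%:R * B j = (m == 0)%:R.
Proof.
case: m => [|m]; first by rewrite big_ord1 bernoulli_num0 mulr1.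
rewrite big_ord_recr /= binSn bernoulli_numS mulrA mulrN divff ?pnatr_eq0 //.
by rewrite mulN1r subrr.
Qed.

(** The truncation of x / (exp x - 1) below degree [N]; working with polynomials
    modulo ['X^N] replaces formal power series. *)
Definition bernoulli_gf N : {poly F} := \poly_(i < N) (B i / (i`!)%:R).
(** The truncation of (exp x - 1) / x below degree [N]. *)
Definition expm1_gf N : {poly F} := \poly_(i < N) ((i.+1)`!%:R)^-1.

Lemma fact_neq0 n : (n`!)%:R != 0 :> F.
Proof. by rewrite pnatr_eq0 -lt0n fact_gt0. Qed.

(** The recurrence that defines the Bernoulli numbers, divided by [(n.+1)`!], says
    that the two generating functions are inverse to each other modulo ['X^N]. *)
Lemma coef_bernoulli_gfM N n : (n < N)%N ->
  (bernoulli_gf N * expm1_gf N)`_n = (n == 0)%:R.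
Proof.
move=> nN; rewrite coefM.
have -> : (n == 0)%:R = (n == 0)%:R / ((n.+1)`!)%:R :> F.
  by case: (n) => [|?]; rewrite ?mul0r// divr1.
rewrite -sum_bernoulli_num mulr_suml; apply: eq_bigr => -[j /= jn] _.
rewrite !coef_poly (leq_ltn_trans _ nN)// (leq_ltn_trans (leq_subr _ _) nN).
rewrite -subSn// -(bin_fact (ltnW jn : j <= n.+1)%N) !natrM.
by have := fact_neq0 j; have := fact_neq0 (n.+1 - j);
  have : 'C(n.+1, j)%:R != 0 :> F by [rewrite pnatr_eq0 -lt0n bin_gt0 ltnW];
  move=> *; field; rewrite ?andbT; do ?[apply/andP; split].
Qed.

(** With E = (exp x - 1) / x, differentiating x E = exp x - 1 gives
    E + x E' = exp x = x E + 1; the last term is the truncation error. *)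
Lemma expm1_gf_ode N :
  expm1_gf N + 'X * (expm1_gf N)^`() = 'X * expm1_gf N + 1 - ((N`!)%:R^-1) *: 'X^N.
Proof.
apply/polyP => -[|n].
  rewrite !(coefD, coefN, coefZ, coefXM, coefXn, coef1, coef_poly) /=.
  by case: N => [|N]; rewrite ?fact0 /= ?mulr0 ?invr1; ring.
rewrite !(coefD, coefN, coefZ, coefXM, coefXn, coef1, coef_poly, coef_deriv) /=.
have e : (n.+2)`!%:R^-1 *+ n.+2 = (n.+1)`!%:R^-1 :> F.
  by rewrite -[LHS]mulr_natr factS natrM invfM mulrAC mulVf ?mul1r ?pnatr_eq0.
case: (ltngtP n.+1 N) => h.
- by rewrite mulr0 subr0 addr0 -mulrS -e.
- by rewrite mul0rn mulr0; ring.
- by rewrite -h mul0rn mulr1; ring.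
Qed.

(** Differentiating p E = 1 and eliminating E' by the equation of E shows that
    p = x / (exp x - 1) solves the Riccati equation x p' + x p + p^2 - p = 0. *)
Lemma bernoulli_gf_ode N n : (n < N)%N ->
  ('X * (bernoulli_gf N)^`() + 'X * bernoulli_gf N
     + bernoulli_gf N ^+ 2 - bernoulli_gf N)`_n = 0.
Proof.
move=> nN.
set p := bernoulli_gf N; set E := expm1_gf N; pose c : {poly F} := ((N`!)%:R^-1)%:P.
have [A eA] : exists A, p * E = 1 + 'X^N * A.
  exists (drop_poly N (p * E)).
  have {1}<- := poly_take_drop N (p * E); rewrite [_ * 'X^N]mulrC.
  congr (_ + _); apply/polyP => i; rewrite coef_take_poly coef1.
  case: ltnP => h; first by rewrite coef_bernoulli_gfM.
  by rewrite gtn_eqF// (leq_trans _ h)// (leq_trans _ nN).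
have ode : 'X * E^`() = 'X * E + 1 - c * 'X^N - E.
  by have := expm1_gf_ode N; rewrite -mul_polyC -/E -/c => <-; ring.
have dA : 'X * (p^`() * E + p * E^`()) = 'X^N * (N%:R * A + 'X * A^`()).
  rewrite -derivM eA derivD derivC derivM derivXn add0r.
  case: N nN {p E c eA ode} A => // N _ A /=.
  by rewrite exprS -mulr_natl; ring.
(* the equations of p E and of E only hold up to multiples of 'X^N; the witness
   collects these multiples after p * (X (p E)') has been expanded *)
have -> : 'X * p^`() + 'X * p + p ^+ 2 - p =
  'X^N * (p * (N%:R * A + 'X * A^`()) - 'X * A * p + c * p ^+ 2 + p * A
           - 'X * p^`() * A).
  have h : p * ('X * (p^`() * E + p * E^`())) =
           'X * p^`() * (p * E) + p ^+ 2 * ('X * E^`()) by ring.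
  have h2 : p ^+ 2 * ('X * E^`()) =
     'X * p * (p * E) + p ^+ 2 - c * 'X^N * p ^+ 2 - p * (p * E).
    by rewrite ode; ring.
  rewrite dA h2 eA in h.
  have {}h : p * ('X^N * (N%:R * A + 'X * A^`())) - ('X * p^`() * ('X^N * A) +
    ('X * p * ('X^N * A) - c * 'X^N * p ^+ 2 - p * ('X^N * A))) =
    'X * p^`() + 'X * p + p ^+ 2 - p by rewrite h; ring.
  by rewrite -h; ring.
by rewrite coefXnM nN.
Qed.

(** The coefficients of x / (exp x - 1) + x / 2 = (x / 2) coth (x / 2), an even
    function; the shift only changes the coefficient of degree one. *)
Definition half_coth_coef n : F := B n / (n`!)%:R + (n == 1)%:R / 2.

Lemma half_coth_coef0 : half_coth_coef 0 = 1.
Proof. by rewrite /half_coth_coef bernoulli_num0 divr1 mul0r addr0. Qed.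

(** Completing the square in the Riccati equation removes the linear term
    x p: q = p + x / 2 satisfies x q' + q^2 - q = x^2 / 4. *)
Lemma half_coth_coef_rec n :
  n.+2%:R * half_coth_coef n.+1 =
  (n == 1)%:R / 4 - \sum_(i < n) half_coth_coef i.+1 * half_coth_coef (n - i).
Proof.
pose N := n.+2.
pose q : {poly F} := bernoulli_gf N + 2^-1 *: 'X.
have qE i : (i < N)%N -> q`_i = half_coth_coef i.
  move=> iN; rewrite coefD coefZ coefX coef_poly iN /half_coth_coef.
  by rewrite mulrC [_ / 2]mulrC.
have ode : ('X * q^`() + q ^+ 2 - q)`_n.+1 = (n == 1)%:R / 4.
  have -> : 'X * q^`() + q ^+ 2 - q =
    ('X * (bernoulli_gf N)^`() + 'X * bernoulli_gf N
       + bernoulli_gf N ^+ 2 - bernoulli_gf N) + (4^-1) *: 'X^2.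
    rewrite /q derivD derivZ derivX -!mul_polyC.
    have -> : 2^-1%:P = 4^-1%:P *+ 2 :> {poly F}.
      by rewrite -polyCMn; congr (_%:P); field.
    have h : 4%:R * 4^-1%:P = 1 :> {poly F}.
      by rewrite -polyC_natr -polyCM divff// pnatr_eq0.
    by ring: h.
  by rewrite coefD bernoulli_gf_ode// add0r coefZ coefXn mulrC.
rewrite -ode coefB coefD coefXM /= coef_deriv expr2 coefM.
rewrite big_ord_recl big_ord_recr /= subn0 subnn !qE// half_coth_coef0.
under eq_bigr => i _.
  rewrite /bump /= add1n subSS !qE; last 2 first.
  - by rewrite (leq_ltn_trans (leq_subr _ _))// ltnW.
  - by rewrite 2!ltnS ltnW// ltnS.
  over.
by rewrite -mulr_natl; ring.
Qed.

(** Each coefficient is, up to a positive factor, minus a sum of products of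
    earlier ones whose indices add up to its own, so that vanishing in odd degree
    and alternation in even degree propagate together. *)
Lemma half_coth_coef_sign n : (0 < n)%N ->
  if odd n then half_coth_coef n = 0 else (-1) ^+ n./2 * half_coth_coef n < 0.
Proof.
elim/ltn_ind: n => -[//|n] IH _.
(* a product of two previous coefficients vanishes unless both indices are
   even, and then the two signs multiply to the one of the next coefficient *)
have term i : (i < n)%N ->
  if odd n.+1 || odd i.+1 then half_coth_coef i.+1 * half_coth_coef (n - i) = 0
  else 0 < (-1) ^+ n.+1./2 * (half_coth_coef i.+1 * half_coth_coef (n - i)).
  move=> iN; have ni : (0 < n - i)%N by rewrite subn_gt0.
  have := IH i.+1 iN isT; have := IH (n - i)%N _ ni.
  rewrite ltnS leq_subr => /(_ isT).
  have e : n.+1 = (i.+1 + (n - i))%N by rewrite addSn subnKC// ltnW.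
  rewrite [in X in _ -> _ -> X]e oddD halfD.
  case: (boolP (odd i.+1)) => [_ _ -> /=|_].
    by rewrite mul0r orbT.
  case: (boolP (odd (n - i))) => [_ -> _|_ /= s2 s1]; first by rewrite mulr0.
  by rewrite add0n exprD mulrACA nmulr_rgt0.
have n2 : n.+2%:R > 0 :> F by rewrite ltr0n.
have n1 : odd n.+1 -> (n == 1)%N = false by case: eqP => // ->.
case: ifPn => on.
  have /eqP := half_coth_coef_rec n; rewrite big1 => [|i _]; last first.
    by have := term i (ltn_ord i); rewrite on.
  by rewrite n1// mul0r subr0 mulf_eq0 pnatr_eq0 => /eqP.
rewrite -(pmulr_rlt0 _ n2) mulrCA half_coth_coef_rec mulrBr mulr_sumr subr_lt0.
have term_ge0 (i : 'I_n) :
    0 <= (-1) ^+ n.+1./2 * (half_coth_coef i.+1 * half_coth_coef (n - i)).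
  have := term i (ltn_ord i); rewrite (negbTE on) /=.
  by case: ifP => [_ ->|_ /ltW//]; rewrite mulr0.
(* in degree two the sum is zero and the right-hand side x^2 / 4 gives the sign;
   from degree four on, the term with indices 2 and n makes the sum positive *)
case: n => [//|[|n]] in IH term n2 n1 on term_ge0 *.
  apply: (@lt_le_trans _ _ 0); last by apply: sumr_ge0 => i _; exact: term_ge0.
  by rewrite /= expr1 mul1r mulN1r oppr_lt0 invr_gt0.
rewrite /= mul0r mulr0 (bigD1 (lift ord0 ord0)) //= ltr_wpDr //.
  by apply: sumr_ge0 => i _; exact: term_ge0.
by have := term 1%N isT; rewrite (negbTE on).
Qed.

Lemma bernoulli_num_sign m : (0 < m)%N -> 0 < (-1) ^+ m.-1 * B (2 * m).
Proof.
case: m => // m _; have := @half_coth_coef_sign m.+1.*2 isT.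
rewrite odd_double doubleK mul2n /half_coth_coef.
rewrite [_ == 1%N]negbTE ?mul0r ?addr0; last by rewrite doubleS.
by rewrite exprS mulrA pmulr_llt0 ?invr_gt0 ?ltr0n ?fact_gt0// mulN1r mulNr oppr_lt0.
Qed.
End BernoulliNumbers.

(** * Polynomials *)

Section Polynomials.
Variable F : idomainType.
Local Open Scope classical_set_scope.

Lemma finite_root (p : {poly F}) : p != 0 -> finite_set [set x | root p x].
Proof.
move=> p0; apply: contrapT => /(infinite_set_fset (size p))[A sA].
rewrite leqNgt => /negP; apply.
apply: max_poly_roots => //; last exact: fset_uniq.
by apply/allP => x xA; exact: sA.
Qed.

(** The system is triangular with nonzero diagonal: the coefficient of the
    highest degree isolates the last weight. *)
Lemma graded_poly_free (P : nat -> {poly F}) N (w : nat -> F) :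
  (forall m, size (P m) = m.+1) ->
  \sum_(m < N) w m *: P m = 0 -> forall m, (m < N)%N -> w m = 0.
Proof.
move=> sP; elim: N => [//|N IH]; rewrite big_ord_recr/= => s0.
have wN : w N = 0.
  have /(congr1 (fun p : {poly F} => p`_N)) := s0.
  rewrite coefD coefZ coef_sum big1 ?add0r ?coef0 => [|m _]; last first.
    by rewrite coefZ nth_default ?mulr0// sP.
  move/eqP; rewrite mulf_eq0 => /orP[/eqP//|].
  have -> : (P N)`_N = lead_coef (P N) by rewrite lead_coefE sP.
  by rewrite lead_coef_eq0 -size_poly_eq0 sP.
move: s0; rewrite wN scale0r addr0 => /IH{}IH m.
by rewrite ltnS leq_eqVlt => /predU1P[->//|]; exact: IH.
Qed.

End Polynomials.

(** * The Riemann-Liouville integral on bounded functions *)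

Section RiemannLiouville.
Local Open Scope classical_set_scope.
Context {R : realType}.
Implicit Types (f h : R -> R).
Local Notation leb := (@lebesgue_measure R).
Local Notation I01 := (`[0, 1]%classic : set R).

(** A class that contains the wavelets, is closed under the algebraic operations
    and under the Riemann-Liouville integral, and consists of square integrable
    functions: inside it, all integrals below are linear without further checks. *)
Definition bounded_mfun01 f :=
  measurable_fun I01 f /\ exists C : R, forall z, I01 z -> `|f z| <= C.

Lemma measurable_I01 : measurable I01. Proof. exact: measurable_itv. Qed.
#[local] Hint Resolve measurable_I01 : core.

Lemma bounded_mfun01_cst c : bounded_mfun01 (fun=> c).
Proof. by split; [exact: measurable_cst|exists `|c|]. Qed.

Lemma bounded_mfun01D f h : bounded_mfun01 f -> bounded_mfun01 h ->
  bounded_mfun01 (fun z => f z + h z).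
Proof.
move=> [mf [C bf]] [mh [D bh]]; split; first exact: measurable_funD.
by exists (C + D) => z Iz; rewrite (le_trans (ler_normD _ _))// lerD ?bf ?bh.
Qed.

Lemma bounded_mfun01M f h : bounded_mfun01 f -> bounded_mfun01 h ->
  bounded_mfun01 (fun z => f z * h z).
Proof.
move=> [mf [C bf]] [mh [D bh]]; split; first exact: measurable_funM.
by exists (C * D) => z Iz; rewrite normrM ler_pM ?bf ?bh.
Qed.

Lemma bounded_mfun01X f n : bounded_mfun01 f -> bounded_mfun01 (fun z => f z ^+ n).
Proof.
move=> bf; elim: n => [|n IH]; first exact: bounded_mfun01_cst.
by under eq_fun do rewrite exprS; exact: bounded_mfun01M.
Qed.

Lemma bounded_mfun01_sum I (r : seq I) (P : pred I) (F : I -> R -> R) :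
  (forall i, P i -> bounded_mfun01 (F i)) ->
  bounded_mfun01 (fun z => \sum_(i <- r | P i) F i z).
Proof.
move=> bF; elim: r => [|i r IH].
  by under eq_fun do rewrite big_nil; exact: bounded_mfun01_cst.
have [Pi|Pi] := boolP (P i); last first.
  by under eq_fun do rewrite big_cons (negbTE Pi).
under eq_fun do rewrite big_cons Pi.
by apply: bounded_mfun01D => //; exact: bF.
Qed.

Lemma bounded_mfun01_integrable f : bounded_mfun01 f ->
  leb.-integrable I01 (EFin \o f).
Proof.
move=> [mf [C bf]]; apply: measurable_bounded_integrable => //.
  by rewrite /= lebesgue_measure_itv /=; case: ifP => _; rewrite ?ltry.
exists C; split; first exact: num_real.
by move=> D CD z Iz /=; rewrite (le_trans (bf _ Iz)) ?ltW.
Qed.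

Lemma bounded_mfun01_square f : bounded_mfun01 f -> square_integrable01 f.
Proof.
move=> bf; split; first by case: bf.
by apply: (bounded_mfun01_integrable (f := fun z => f z ^+ 2)); exact: bounded_mfun01X.
Qed.

Variable mu : R.
Hypothesis mu_gt0 : 0 < mu.

Lemma is_derive_kernel (z s : R) : s < z ->
  is_derive s 1 (fun s => - ((z - s) `^ mu / mu)) ((z - s) `^ (mu - 1)).
Proof.
move=> sz.
have zs : 0 < z - s by rewrite subr_gt0.
have h1 : is_derive s 1 (fun s : R => z - s) (0 - 1) by apply: is_deriveB.
have h2 := is_derive1_powR mu zs.
have h3 := @is_derive1_comp _ (@powR R ^~ mu) (fun s : R => z - s) s _ _ h2 h1.
have h4 := is_deriveZ (- mu^-1) h3.
rewrite (_ : (fun s => _) = - mu^-1 \*: (@powR R ^~ mu \o (fun s : R => z - s))).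
  by apply: (is_derive_eq h4); rewrite /GRing.scale /=; field; rewrite gt_eqF.
by apply/funext => t; rewrite -mulrN mulrC.
Qed.

Lemma continuous_kernel (z s : R) : s < z ->
  {for s, continuous (fun s : R => (z - s) `^ (mu - 1))}.
Proof.
move=> sz; apply: differentiable_continuous; apply/derivable1_diffP.
have zs : 0 < z - s by rewrite subr_gt0.
have h1 : is_derive s 1 (fun s : R => z - s) (0 - 1) by apply: is_deriveB.
have h2 := is_derive1_powR (mu - 1) zs.
by have [] := @is_derive1_comp _ (@powR R ^~ (mu - 1)) (fun s : R => z - s) s _ _ h2 h1.
Qed.

Lemma measurable_kernel (z : R) D : measurable_fun D (fun s : R => (z - s) `^ (mu - 1)).
Proof.
apply: measurable_funTS.
apply: (@measurableT_comp _ _ _ _ _ _ (@powR R ^~ (mu - 1))) => //.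
exact: measurable_funB.
Qed.

(** For [mu < 1] the kernel blows up at [s = z], so that the fundamental theorem of
    calculus only applies away from that endpoint. *)
Lemma integral_kernel_trunc (z c : R) : 0 <= c < z ->
  (\int[leb]_(s in `[0%R, c]) ((z - s) `^ (mu - 1))%:E <= (z `^ mu / mu)%:E)%E.
Proof.
rewrite le_eqVlt => /andP[/predU1P[<-|c0] cz].
  by rewrite set_itv1 integral_set1 lee_fin divr_ge0 ?powR_ge0 ?ltW.
rewrite (@continuous_FTC2 _ _ (fun s => - ((z - s) `^ mu / mu))) //=.
- rewrite subr0 -EFinD lee_fin opprK gerDr oppr_le0.
  by rewrite divr_ge0 ?powR_ge0 ?ltW.
- apply: continuous_in_subspaceT => s; rewrite inE /= in_itv/= => /andP[_ sc].
  by apply: continuous_kernel; exact: le_lt_trans sc cz.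
- have dF s : s <= c -> derivable (fun s => - ((z - s) `^ mu / mu)) s 1.
    by move=> sc; have [] := is_derive_kernel (le_lt_trans sc cz).
  split.
  + by move=> s; rewrite in_itv/= => /andP[_ /ltW]; exact: dF.
  + apply: cvg_at_right_filter.
    apply: (differentiable_continuous (f := fun s => - ((z - s) `^ mu / mu))).
    by apply/derivable1_diffP/dF/ltW.
  + apply: cvg_at_left_filter.
    apply: (differentiable_continuous (f := fun s => - ((z - s) `^ mu / mu))).
    exact/derivable1_diffP/dF.
- move=> s; rewrite in_itv/= => /andP[_ sc].
  by rewrite derive1E; have [_] := is_derive_kernel (lt_trans sc cz).
Qed.

(** Monotone convergence along [`[0, z - z / n.+1]] reaches the singular
    endpoint, the bounds of the truncated integrals being uniform. *)
Lemma integral_kernel_le (z : R) : 0 <= z ->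
  (\int[leb]_(s in `[0%R, z]) ((z - s) `^ (mu - 1))%:E <= (z `^ mu / mu)%:E)%E.
Proof.
rewrite le_eqVlt => /predU1P[<-|z0].
  by rewrite set_itv1 integral_set1 lee_fin divr_ge0 ?powR_ge0 ?ltW.
have mK D : measurable_fun D (fun s : R => ((z - s) `^ (mu - 1))%:E).
  by apply/measurable_EFinP; exact: measurable_kernel.
rewrite -integral_itv_bndo_bndc//.
pose c (n : nat) : R := z - z / n.+1%:R.
have cz n : 0 <= c n < z.
  rewrite /c subr_ge0 ltrBlDr ltrDl divr_gt0// andbT ler_pdivrMr//.
  by apply: ler_peMr; [exact: ltW|rewrite ler1n].
have -> : `[0, z[%classic = \bigcup_n (`[0, c n]%classic : set R).
  apply/seteqP; split => s /=; rewrite in_itv/=; last first.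
    move=> [n _] /=; rewrite in_itv/= => /andP[-> sc].
    by case/andP: (cz n) => _; exact: le_lt_trans.
  (* s <= z - z / n.+1 as soon as z / (z - s) <= n.+1 *)
  move=> /andP[s0 sz]; exists (Num.truncn (z / (z - s))) => //=.
  rewrite in_itv/= s0 /c lerBrDl -lerBrDr ler_pdivrMr//.
  rewrite mulrC -ler_pdivrMr ?subr_gt0//.
  by apply: ltW; rewrite truncnS_gt.
have ndc : nondecreasing_seq (fun n => `[0, c n]%classic : set R).
  apply/nondecreasing_seqP => n; rewrite subsetEset; apply: subset_itvl.
  rewrite bnd_simp /c lerD2l lerN2 ler_pM2l// lef_pV2 ?posrE ?ltr0n// ler_nat.
  exact: leqnSn.
have cvg := ge0_nondecreasing_set_cvg_integral (mu := leb) ndc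
  (fun i => measurable_itv _) (fun i => mK _).
have {}cvg := cvg (fun i s _ => powR_ge0 (z - s) (mu - 1)).
rewrite -(cvg_lim _ cvg)//.
apply: lime_le; first by apply/cvg_ex; eexists; exact: cvg.
by apply: nearW => n; exact: integral_kernel_trunc.
Qed.

Lemma kernel_integrable h (z : R) : bounded_mfun01 h -> I01 z ->
  leb.-integrable `[0, z] (EFin \o (fun s : R => (z - s) `^ (mu - 1) * h s)).
Proof.
move=> [mh [C bh]] /=; rewrite in_itv/= => /andP[z0 z1].
have sub : `[0, z]%classic `<=` I01 by apply: subset_itvl; rewrite bnd_simp.
have kI : leb.-integrable `[0, z] (EFin \o (fun s : R => C * (z - s) `^ (mu - 1))).
  suff k1 : leb.-integrable `[0, z] (EFin \o (fun s : R => (z - s) `^ (mu - 1))).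
    exact: (integrableZl (mu := leb) (measurable_itv _) C k1).
  apply/integrableP; split; first by apply/measurable_EFinP; exact: measurable_kernel.
  under eq_integral do rewrite /= ger0_norm ?powR_ge0//.
  by rewrite (le_lt_trans (integral_kernel_le z0)) ?ltry.
apply: le_integrable kI => //.
  apply/measurable_EFinP/measurable_funM; first exact: measurable_kernel.
  by apply: measurable_funS mh.
move=> s zs; rewrite /= lee_fin !normrM mulrC ler_wpM2r// (le_trans (bh _ _)) ?ler_norm//.
exact: sub.
Qed.

(** [RLint mu h] is a section integral of a jointly measurable function, the
    triangle [0 <= s <= z] being encoded by its indicator; the theorem of Tonelli
    applies to its positive and negative parts. *)
Lemma measurable_RLint h : measurable_fun I01 h ->
  measurable_fun I01 (RLint mu h).
Proof.
move=> mh; apply: measurable_funM; first exact: measurable_cst.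
pose Phi (x : R * R) : \bar R :=
  ((x.1 - x.2) `^ (mu - 1) *
   ((h \_ I01) x.2 * \1_[set x : R * R | 0 <= x.2 <= x.1] x))%:E.
have mPhi : measurable_fun setT Phi.
  apply/measurable_EFinP/measurable_funM.
    apply: (@measurableT_comp _ _ _ _ _ _ (@powR R ^~ (mu - 1))) => //.
    by apply: measurable_funB; [exact: measurable_fst|exact: measurable_snd].
  apply: measurable_funM.
    apply: (@measurableT_comp _ _ _ _ _ _ (h \_ I01)); last exact: measurable_snd.
    exact/(measurable_restrictT h).
  apply: measurable_indic.
  rewrite [X in measurable X](_ : _ =
      [set x : R * R | 0 <= x.2] `&` [set x | x.2 <= x.1]).
    apply: measurableI.
      rewrite -[X in measurable X]setTI.
      exact: measurable_fun_le.
    rewrite -[X in measurable X]setTI.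
    exact: measurable_fun_le.
  by apply/seteqP; split => x /= /andP.
have mF : measurable_fun setT (fun z => \int[leb]_s Phi (z, s))%E.
  rewrite (_ : (fun z => _) = (fun z =>
      \int[leb]_s Phi^\+ (z, s) - \int[leb]_s Phi^\- (z, s))%E).
    apply: emeasurable_funB.
      by apply: measurable_fun_fubini_tonelli_F => //; exact: measurable_funepos.
    by apply: measurable_fun_fubini_tonelli_F => //; exact: measurable_funeneg.
  apply/funext => z; rewrite integralE.
  under eq_integral do rewrite funepos_comp/=.
  by under [X in (_ - X)%E]eq_integral do rewrite funeneg_comp/=.
apply: (@eq_measurable_fun _ _ _ _ _ (fun z => fine (\int[leb]_s Phi (z, s)))).
  move=> z /set_mem /=; rewrite in_itv/= => /andP[z0 z1].
  rewrite Rintegral_mkcond /Rintegral; congr fine; apply: eq_integral => s _.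
  rewrite /Phi /= !patchE indicE; congr EFin.
  have -> : ((z, s) \in [set x : R * R | 0 <= x.2 <= x.1]) = (s \in `[0, z]%classic).
    by apply/idP/idP => /set_mem /= H; apply/mem_set; rewrite ?in_itv //= ?in_itv in H *.
  case: (boolP (s \in `[0, z]%classic)) => [|_]; last by rewrite /= !mulr0.
  move=> /set_mem /=; rewrite in_itv/= => /andP[s0 sz].
  by rewrite mulr1 mem_set//= in_itv/= s0 (le_trans sz).
by apply: measurable_funTS; exact: measurableT_comp.
Qed.

Lemma bounded_mfun01_RLint h : bounded_mfun01 h -> bounded_mfun01 (RLint mu h).
Proof.
move=> bh; split; first by case: bh => mh _; exact: measurable_RLint.
have [mh [C bC]] := bh.
exists (`|(Gamma mu)^-1| * (C / mu)) => z Iz.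
rewrite /RLint normrM ler_wpM2l//.
have [z0 z1] : 0 <= z /\ z <= 1 by apply/andP; move: Iz; rewrite /= in_itv.
have C0 : 0 <= C by rewrite (le_trans _ (bC _ Iz)).
rewrite -lee_fin EFin_normr_Rintegral//; last exact: kernel_integrable.
have /integrableP[miK _] := kernel_integrable bh Iz.
apply: (le_trans (le_abse_integral _ _ _)) => //.
apply: (@le_trans _ _ (\int[leb]_(s in `[0%R, z]) (C%:E * ((z - s) `^ (mu - 1))%:E))%E).
  apply: ge0_le_integral => //=.
  - by do 2 apply: measurableT_comp => //; exact/measurable_EFinP.
  - apply/measurable_EFinP; apply: measurable_funM => //; exact: measurable_kernel.
  move=> s; rewrite in_itv/= => /andP[s0 sz].
  rewrite lee_fin normrM ger0_norm ?powR_ge0// mulrC ler_wpM2r ?powR_ge0//.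
  by apply: bC; rewrite /= in_itv/= s0 (le_trans sz).
rewrite ge0_integralZl//; last 2 first.
- by apply/measurable_EFinP; exact: measurable_kernel.
- by move=> s _; rewrite lee_fin powR_ge0.
rewrite EFinM lee_wpmul2l ?lee_fin// (le_trans (integral_kernel_le z0))//.
rewrite lee_fin ler_pdivrMr// mulVf ?gt_eqF//.
have := @ge0_ler_powR _ _ (ltW mu_gt0) z 1; rewrite powR1; apply => //.
by rewrite nnegrE.
Qed.

Lemma RLintD f h z : bounded_mfun01 f -> bounded_mfun01 h -> I01 z ->
  RLint mu (fun s => f s + h s) z = RLint mu f z + RLint mu h z.
Proof.
move=> bf bh Iz; rewrite /RLint -mulrDr -RintegralD//; last 2 first.
- exact: kernel_integrable.
- exact: kernel_integrable.
by congr (_ * _); apply: eq_Rintegral => s _; rewrite mulrDr.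
Qed.

Lemma RLintZ c f z : bounded_mfun01 f -> I01 z ->
  RLint mu (fun s => c * f s) z = c * RLint mu f z.
Proof.
move=> bf Iz; rewrite /RLint mulrCA -[in RHS]RintegralZl//; last exact: kernel_integrable.
by congr (_ * _); apply: eq_Rintegral => s _; rewrite mulrCA.
Qed.

Lemma RLint_sum I (r : seq I) (F : I -> R -> R) z :
  (forall i, bounded_mfun01 (F i)) -> I01 z ->
  RLint mu (fun s => \sum_(i <- r) F i s) z = \sum_(i <- r) RLint mu (F i) z.
Proof.
move=> bF Iz; elim: r => [|i r IH].
  rewrite big_nil (_ : (fun s => _) = (fun s => 0 * 0)).
    by rewrite RLintZ ?mul0r//; exact: bounded_mfun01_cst.
  by apply/funext => s; rewrite big_nil mul0r.
rewrite big_cons -IH -RLintD//; last by apply: bounded_mfun01_sum.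
by congr (RLint mu _ z); apply/funext => s; rewrite big_cons.
Qed.

End RiemannLiouville.

(** * Wavelets, their integrals and their coefficients *)

Section Coefficients.
Local Open Scope classical_set_scope.
Context {R : realType}.
Variables (mu : R) (k M : nat).
Hypothesis mu_gt0 : 0 < mu.
Local Notation leb := (@lebesgue_measure R).
Local Notation B := (bernoulli_num R).
Local Notation I01 := (`[0, 1]%classic : set R).

(** The radicand is positive because the sign of [B (2 * m)] is [(-1) ^+ m.-1];
    otherwise some wavelets would be zero and the Gram matrix singular. *)
Lemma xi_neq0 m : xi k m != 0 :> R.
Proof.
rewrite /xi; case: m => [|m] /=; first by rewrite gt_eqF// powR_gt0.
rewrite gt_eqF// sqrtr_gt0 [(_ ^+ m * _)%R]mulrC -[X in _ / X]mulrA.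
apply: divr_gt0; first by rewrite mulr_gt0 ?exprn_gt0 ?ltr0n ?fact_gt0.
rewrite mulr_gt0 ?exprn_gt0 ?ltr0n ?fact_gt0//.
exact: (@bernoulli_num_sign R m.+1).
Qed.

Lemma bounded_mfun01_powR p : 0 <= p -> bounded_mfun01 (fun z : R => z `^ p).
Proof.
move=> p0; split; first by apply: measurable_funTS; exact: measurable_powR.
exists 1 => z; rewrite /= in_itv/= => /andP[z0 z1].
rewrite ger0_norm ?powR_ge0//.
by have := @ge0_ler_powR _ _ p0 z 1; rewrite powR1; apply => //; rewrite nnegrE.
Qed.

Lemma bounded_mfun01_chi n : bounded_mfun01 (chi mu k n).
Proof.
split; first by apply: measurable_indic; exact: measurable_itv.
by exists 1 => z _; rewrite /chi indicE; case: (_ \in _); rewrite ?normr1 ?normr0.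
Qed.

Lemma bounded_mfun01_psi n m : bounded_mfun01 (psi mu k n m).
Proof.
apply: bounded_mfun01M; last exact: bounded_mfun01_chi.
apply: bounded_mfun01M; first exact: bounded_mfun01_cst.
apply: bounded_mfun01_sum => j _.
apply: bounded_mfun01M; first exact: bounded_mfun01_cst.
apply: bounded_mfun01X; apply: bounded_mfun01D; last exact: bounded_mfun01_cst.
exact/bounded_mfun01_powR/ltW.
Qed.

Lemma Psi_entry (n : 'I_(2 ^ k.-1)) (m : 'I_M) z :
  Psi mu k M z (mxvec_index n m) 0 = psi mu k n.+1 m z.
Proof. by rewrite mxE mxvecE mxE. Qed.

Lemma bounded_mfun01_Psi i : bounded_mfun01 (fun z => Psi mu k M z i 0).
Proof.
case/mxvec_indexP: i => n m.
by under eq_fun do rewrite Psi_entry; exact: bounded_mfun01_psi.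
Qed.

Lemma Rintegral01Z c (f : R -> R) : bounded_mfun01 f ->
  \int[leb]_(z in `[0, 1]) (c * f z) = c * \int[leb]_(z in `[0, 1]) f z.
Proof.
by move=> bf; rewrite RintegralZl//; exact: bounded_mfun01_integrable.
Qed.

Lemma Rintegral01_sum I (r : seq I) (F : I -> R -> R) :
  (forall i, bounded_mfun01 (F i)) ->
  \int[leb]_(z in `[0, 1]) (\sum_(i <- r) F i z) =
  \sum_(i <- r) \int[leb]_(z in `[0, 1]) F i z.
Proof.
move=> bF; elim: r => [|i r IH].
  under eq_Rintegral do rewrite big_nil.
  by rewrite Rintegral_cst// mul0r big_nil.
under eq_Rintegral do rewrite big_cons.
rewrite big_cons -IH RintegralD//; first exact: bounded_mfun01_integrable.
by apply: bounded_mfun01_integrable; exact: bounded_mfun01_sum.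
Qed.

Lemma eq_fbw_coef (f h : R -> R) : (forall z, I01 z -> f z = h z) ->
  fbw_coef mu k M f = fbw_coef mu k M h.
Proof.
move=> fh; congr (_ *m _); apply/rowP => j; rewrite !mxE.
by apply: eq_Rintegral => z /set_mem Iz; rewrite !mxE fh.
Qed.

Lemma fbw_coefZ c (f : R -> R) : bounded_mfun01 f ->
  fbw_coef mu k M (fun z => c * f z) = c *: fbw_coef mu k M f.
Proof.
move=> bf; rewrite /fbw_coef scalemxAl; congr (_ *m _).
apply/rowP => j; rewrite !mxE -Rintegral01Z.
  by apply: eq_Rintegral => z _; rewrite !mxE mulrA.
under eq_fun do rewrite !mxE; apply: bounded_mfun01M => //.
by have := bounded_mfun01_Psi j; under eq_fun do rewrite mxE.
Qed.

Lemma fbw_coef_sum I (r : seq I) (F : I -> R -> R) :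
  (forall i, bounded_mfun01 (F i)) ->
  fbw_coef mu k M (fun z => \sum_(i <- r) F i z) =
  \sum_(i <- r) fbw_coef mu k M (F i).
Proof.
move=> bF; rewrite /fbw_coef -mulmx_suml; congr (_ *m _).
apply/rowP => j; rewrite summxE !mxE.
under [RHS]eq_bigr do rewrite mxE; rewrite -Rintegral01_sum => [|i].
  apply: eq_Rintegral => z _; rewrite !mxE mulr_suml.
  by apply: eq_bigr => i _; rewrite !mxE.
under eq_fun do rewrite !mxE; apply: bounded_mfun01M => //.
by have := bounded_mfun01_Psi j; under eq_fun do rewrite mxE.
Qed.

(** The coefficient of [s `^ (mu * q) * chi s] contributed by the j-th term of
    the wavelet. *)
Definition psi_coef n m j q : R :=
  xi k m * ('C(m, j)%:R * 'C(j, q)%:R * B (m - j) * 2 ^+ (k.-1 * q) *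
            (-1) ^+ (j - q) * (n%:R - 1) ^+ (j - q)).

(** The factor [2 ^+ (k.-1 * j)] turns the j-th power of the shifted variable into
    [(2 ^+ k.-1 * s `^ mu - (n - 1)) ^+ j], which the binomial theorem expands. *)
Lemma psiE n m (s : R) : psi mu k n m s =
  \sum_(j < m.+1) \sum_(q < j.+1)
    psi_coef n m j q * (s `^ (mu * q%:R) * chi mu k n s).
Proof.
rewrite /psi mulr_sumr mulr_suml; apply: eq_bigr => j _.
have e : 2 ^+ (k.-1 * j) * (s `^ mu - (n%:R - 1) / 2 ^+ k.-1) ^+ j =
  \sum_(q < j.+1) 'C(j, q)%:R * 2 ^+ (k.-1 * q) * (-1) ^+ (j - q) *
     (n%:R - 1) ^+ (j - q) * s `^ (mu * q%:R) :> R.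
  rewrite exprM -exprMn mulrBr mulrCA divff ?expf_neq0 ?pnatr_eq0// mulr1.
  rewrite addrC exprDn; apply: eq_bigr => q _.
  rewrite [(- (n%:R - 1)) ^+ _]exprNn exprMn powRrM powR_mulrn ?powR_ge0//.
  by rewrite -exprM -mulr_natl; ring.
rewrite -[X in _ * X * _]mulrA e mulr_sumr mulr_sumr mulr_suml.
by apply: eq_bigr => q _; rewrite /psi_coef; ring.
Qed.

Lemma bounded_mfun01_powR_chi n q :
  bounded_mfun01 (fun s => s `^ (mu * q%:R) * chi mu k n s).
Proof.
apply: bounded_mfun01M; last exact: bounded_mfun01_chi.
by apply: bounded_mfun01_powR; rewrite mulr_ge0// ltW.
Qed.

Lemma bounded_mfun01_g n q : bounded_mfun01 (g mu k n q).
Proof. by apply: bounded_mfun01_RLint => //; exact: bounded_mfun01_powR_chi. Qed.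

Lemma RLint_psi n m z : I01 z -> RLint mu (psi mu k n m) z =
  \sum_(j < m.+1) \sum_(q < j.+1) psi_coef n m j q * g mu k n q z.
Proof.
move=> Iz; rewrite (funext (psiE n m)).
have bt j q : bounded_mfun01
    (fun s => psi_coef n m j q * (s `^ (mu * q%:R) * chi mu k n s)).
  by apply: bounded_mfun01M; [exact: bounded_mfun01_cst|exact: bounded_mfun01_powR_chi].
rewrite RLint_sum// => [|j]; last exact: bounded_mfun01_sum.
apply: eq_bigr => j _; rewrite RLint_sum//; apply: eq_bigr => q _.
by rewrite RLintZ//; exact: bounded_mfun01_powR_chi.
Qed.

(** The separate formula for the first cell is the general one: there the shift
    [n - 1] is zero, so that only the terms with [q = j] survive. *)
Lemma ThetaE n m (r : 'I_(2 ^ k.-1)) (l : 'I_M) : Theta mu n m r l =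
  \sum_(j < m.+1) \sum_(q < j.+1) psi_coef n m j q * g_coef mu k M n q r l.
Proof.
rewrite /Theta; case: eqP => [->|_]; rewrite mulr_sumr; apply: eq_bigr => j _.
  rewrite big_ord_recr/= big1 => [|q _].
    by rewrite /psi_coef subnn binn add0r; ring.
  rewrite /psi_coef subrr [0 ^+ _]expr0n subn_eq0 leqNgt ltn_ord/= mulr0n.
  by rewrite !(mulr0, mul0r).
by rewrite mulr_sumr; apply: eq_bigr => q _; rewrite /psi_coef; ring.
Qed.

(** Both the integral and the coefficient vector are linear, so the expansion of
    the wavelet into powers carries over to its coefficients. *)
Lemma fbw_coef_RLint_psi n m :
  fbw_coef mu k M (RLint mu (psi mu k n m)) = mxvec (Theta_mx mu k M n m).
Proof.
rewrite (eq_fbw_coef (@RLint_psi n m)).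
have bt j q : bounded_mfun01 (fun z => psi_coef n m j q * g mu k n q z).
  by apply: bounded_mfun01M; [exact: bounded_mfun01_cst|exact: bounded_mfun01_g].
rewrite fbw_coef_sum => [|j]; last exact: bounded_mfun01_sum.
apply: (can_inj vec_mxK); rewrite mxvecK linear_sum.
apply/matrixP => r l; rewrite summxE mxE ThetaE; apply: eq_bigr => j _.
rewrite fbw_coef_sum// linear_sum summxE; apply: eq_bigr => q _.
by rewrite fbw_coefZ ?linearZ ?mxE//; exact: bounded_mfun01_g.
Qed.

End Coefficients.

(** * Invertibility of the Gram matrix *)

Section GramMatrix.
Local Open Scope classical_set_scope.
Context {R : realType}.
Variables (mu : R) (k M : nat).
Hypothesis mu_gt0 : 0 < mu.
Local Notation leb := (@lebesgue_measure R).
Local Notation B := (bernoulli_num R).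
Local Notation I01 := (`[0, 1]%classic : set R).

(** On the n-th cell (counted from zero) the wavelet of degree m is, up to the
    factor [xi k m], this polynomial in [z `^ mu - n / 2 ^+ k.-1]. *)
Definition cell_poly m : {poly R} :=
  \poly_(j < m.+1) ('C(m, j)%:R * B (m - j) * 2 ^+ (k.-1 * j)).

Lemma size_cell_poly m : size (cell_poly m) = m.+1.
Proof.
apply: size_poly_eq.
by rewrite binn subnn bernoulli_num0 !mul1r expf_neq0 ?pnatr_eq0.
Qed.

Definition node (n : nat) : R := (n%:R / 2 ^+ k.-1) `^ mu^-1.

Lemma le_node : {homo node : m n / (m <= n)%N >-> m <= n}.
Proof.
move=> m n mn; apply: ge0_ler_powR; rewrite ?nnegrE ?invr_ge0 ?divr_ge0//.
  exact: ltW.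
by rewrite ler_wpM2r ?invr_ge0 ?exprn_ge0// ler_nat.
Qed.

Lemma lt_nodeS n : node n < node n.+1.
Proof.
apply: gt0_ltr_powR; rewrite ?nnegrE ?invr_gt0 ?divr_ge0//.
by rewrite ltr_pM2r ?invr_gt0 ?exprn_gt0// ltr_nat.
Qed.

Lemma node_last : node (2 ^ k.-1) = 1.
Proof. by rewrite /node natrX divff ?powR1// expf_neq0 ?pnatr_eq0. Qed.

Lemma chiE n z : chi mu k n.+1 z = (node n <= z < node n.+1)%R%:R.
Proof.
rewrite /chi indicE -[n.+1%:R]natr1 addrK natr1.
by congr ((nat_of_bool _)%:R); rewrite /node; apply/idP/idP => [/set_mem|H];
  [|apply/mem_set]; rewrite /= in_itv.
Qed.

Lemma psi_in n m z : node n <= z < node n.+1 ->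
  psi mu k n.+1 m z = xi k m * (cell_poly m).[z `^ mu - n%:R / 2 ^+ k.-1].
Proof.
by move=> nz; rewrite /psi chiE nz mulr1 -[n.+1%:R]natr1 addrK horner_poly.
Qed.

Lemma psi_out n n' m z : node n <= z < node n.+1 -> n' != n ->
  psi mu k n'.+1 m z = 0.
Proof.
move=> /andP[nz zn]; rewrite neq_ltn => nn'; rewrite /psi chiE.
rewrite (_ : (_ <= z < _) = false) ?mulr0//; apply/negbTE/negP => /andP[n'z zn'].
case/orP: nn' => nn'.
  by have := lt_le_trans zn' (le_trans (le_node nn') nz); rewrite ltxx.
by have := lt_le_trans zn (le_trans (le_node nn') n'z); rewrite ltxx.
Qed.

(** A vector in the kernel gives a combination S of the wavelets orthogonal to
    each of them, hence to itself, so S vanishes almost everywhere. On a cell, S is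
    a polynomial in [z `^ mu] shifted; if it were nonzero it would vanish only at
    finitely many points, whereas the cell has positive measure. So it is zero, and
    the polynomials of a cell are linearly independent. *)
Lemma fbw_gram_unit : fbw_gram mu k M \in unitmx.
Proof.
rewrite -row_free_unit; apply: inj_row_free => v vG.
pose S z := \sum_i v 0 i * Psi mu k M z i 0.
have bv i : bounded_mfun01 (fun z => v 0 i * Psi mu k M z i 0).
  by apply: bounded_mfun01M; [exact: bounded_mfun01_cst|exact: bounded_mfun01_Psi].
have bS : bounded_mfun01 S by exact: bounded_mfun01_sum.
have orth j : \int[leb]_(z in `[0, 1]) (S z * Psi mu k M z j 0) = 0.
  have /rowP/(_ j) := vG; rewrite !mxE => vGj; rewrite -[RHS]vGj.
  transitivity (\sum_i \int[leb]_(z in `[0, 1])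
      (v 0 i * Psi mu k M z i 0 * Psi mu k M z j 0)).
    rewrite -Rintegral01_sum => [|i].
      by apply: eq_Rintegral => z _; rewrite mulr_suml.
    by apply: bounded_mfun01M => //; exact: bounded_mfun01_Psi.
  apply: eq_bigr => i _; rewrite !mxE -Rintegral01Z.
    apply: eq_Rintegral => z _.
    by rewrite [in RHS]mxE big_ord1 [X in _ * (_ * X)]mxE mulrA.
  under eq_fun do rewrite mxE big_ord1 [X in _ * X]mxE.
  by apply: bounded_mfun01M; exact: bounded_mfun01_Psi.
have S2 : \int[leb]_(z in `[0, 1]) (S z ^+ 2) = 0.
  transitivity (\sum_i \int[leb]_(z in `[0, 1])
      (v 0 i * (S z * Psi mu k M z i 0))).
    rewrite -Rintegral01_sum => [|i].
      apply: eq_Rintegral => z _; rewrite expr2 {2}/S mulr_sumr.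
      by apply: eq_bigr => i _; rewrite mulrCA.
    apply: bounded_mfun01M; first exact: bounded_mfun01_cst.
    by apply: bounded_mfun01M => //; exact: bounded_mfun01_Psi.
  rewrite big1// => i _; rewrite Rintegral01Z ?orth ?mulr0//.
  by apply: bounded_mfun01M => //; exact: bounded_mfun01_Psi.
have S0 : {ae leb, forall z, I01 z -> S z = 0}.
  have iS2 : leb.-integrable I01 (EFin \o (fun z => S z ^+ 2)).
    by apply: bounded_mfun01_integrable; exact: bounded_mfun01X.
  have /integrableP[mS2 _] := iS2.
  have : ae_eq leb I01 (EFin \o (fun z => S z ^+ 2)) (cst 0%E).
    apply/ae_eq_integral_abs => //.
    under eq_integral do rewrite gee0_abs ?lee_fin ?sqr_ge0//.
    rewrite -[LHS]fineK; last exact: integrable_fin_num.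
    by congr EFin.
  apply: filterS => z /= h /h /eqP.
  by rewrite eqe sqrf_eq0 => /eqP.
apply/rowP => i; rewrite mxE; case/mxvec_indexP: i => n m.
pose c : R := n%:R / 2 ^+ k.-1.
(* [graded_poly_free] takes weights on nat: they are zero outside 'I_M *)
pose w l := if insub l is Some l then v 0 (mxvec_index n l) * xi k l else 0 : R.
have wE (l : 'I_M) : w l = v 0 (mxvec_index n l) * xi k l by rewrite /w valK.
pose Q := \sum_(l < M) w l *: cell_poly l.
have SE z : node n <= z < node n.+1 -> S z = Q.[z `^ mu - c].
  move=> nz; rewrite /S /Q horner_sum.
  rewrite (reindex _ (curry_mxvec_bij _ _))/=.
  rewrite (eq_bigr (fun p : 'I_(2 ^ k.-1) * 'I_M =>
     v 0 (mxvec_index p.1 p.2) * psi mu k p.1.+1 p.2 z)); last first.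
    by case=> n' l _; rewrite Psi_entry.
  rewrite -(pair_bigA _ (fun (n' : 'I_(2 ^ k.-1)) (l : 'I_M) =>
    v 0 (mxvec_index n' l) * psi mu k n'.+1 l z)) (bigD1 n)//=.
  rewrite [X in _ + X]big1 ?addr0 => [|n' n'n]; last first.
    by apply: big1 => l _; rewrite (psi_out _ nz) ?mulr0.
  by apply: eq_bigr => l _; rewrite (psi_in _ nz) wE hornerZ mulrA.
have Q0 : Q = 0.
  apply/eqP/negPn/negP => /finite_root fQ.
  have [N [mN N0 sN]] := S0.
  (* t |-> (t + c) `^ mu^-1 inverts z |-> z `^ mu - c on nonnegative z *)
  pose A := [set (t + c) `^ mu^-1 | t in [set t | root Q t]].
  have A0 : leb A = 0.
    by apply/countable_lebesgue_measure0/finite_set_countable/finite_image.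
  pose C : set R := `[node n, node n.+1[%classic.
  have : leb.-negligible C.
    apply: (@negligibleS _ _ _ leb (A `|` N) C).
      move=> z; rewrite /C /= in_itv/= => nz.
      have Iz : I01 z.
        rewrite /= in_itv/= (le_trans _ (proj1 (andP nz))) ?powR_ge0//=.
        rewrite -node_last (le_trans (ltW (proj2 (andP nz))))//.
        exact: le_node.
      have [/eqP Sz|Sz] := boolP (S z == 0); [left|right].
        exists (z `^ mu - c); first by apply/rootP; rewrite -SE.
        rewrite subrK -powRrM mulfV ?gt_eqF// powRr1//.
        by move: Iz; rewrite /= in_itv => /andP[].
      by apply: sN => /= /(_ Iz) /eqP; apply/negP.
    apply: negligibleU; last by exists N; split.
    exists A; split => //.
    by apply/countable_measurable/finite_set_countable/finite_image.
  move=> /(measure_negligible (mu := leb) (measurable_itv _)) C0.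
  have : leb C = 0%E := C0.
  rewrite /C lebesgue_measure_itv/= lte_fin lt_nodeS -EFinB => /eqP.
  by rewrite eqe subr_eq0 gt_eqF// lt_nodeS.
have := graded_poly_free size_cell_poly Q0 (ltn_ord m); rewrite wE => /eqP.
by rewrite mulf_eq0 (negbTE (xi_neq0 _ _)) orbF => /eqP.
Qed.

End GramMatrix.

Theorem theorem5p1 (R : realType) (mu : R) (k M : nat)
    (mu_gt0 : 0 < mu) (k_ge1 : (1 <= k)%N) (M_ge1 : (1 <= M)%N) :
  fbw_approx_vec mu (RLint_vec mu (Psi mu k M)) (Pmx mu k M) /\
  (forall (n : 'I_(2 ^ k.-1)) (m : 'I_M),
     fbw_approx mu (RLint mu (psi mu k n.+1 m)) (mxvec (Theta_mx mu k M n.+1 m))).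
Proof.
have approx (n : 'I_(2 ^ k.-1)) (m : 'I_M) :
    fbw_approx mu (RLint mu (psi mu k n.+1 m)) (mxvec (Theta_mx mu k M n.+1 m)).
  split; [|exact: fbw_gram_unit|by rewrite fbw_coef_RLint_psi].
  by apply/bounded_mfun01_square/bounded_mfun01_RLint => //; exact: bounded_mfun01_psi.
split=> // i; case/mxvec_indexP: i => n m.
have -> : (fun z => RLint_vec mu (Psi mu k M) z (mxvec_index n m) 0) =
    RLint mu (psi mu k n.+1 m).
  apply/funext => z; rewrite mxE; congr (RLint mu _ z).
  by apply/funext => s; exact: Psi_entry.
rewrite (_ : row _ _ = mxvec (Theta_mx mu k M n.+1 m)) //.
by apply/rowP => j; rewrite !mxE mxvecE mxE.
Qed.
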